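(* For every integer $n\ge 4$, the number of distinct interval posets $P(\pi)$, where $\pi$ ranges over the block-wise simple permutations in $\mathcal{S}_n$, equals $$\frac{1}{n}\sum_{i=1}^{\lfloor (n-1)/3\rfloor}\binom{n+i-1}{i}\binom{n-2i-2}{i-1}.$$
   Context: $\mathcal{S}_n$ is the set of permutations of $\{1,\dots,n\}$, written in one-line notation. An interval of $\pi=a_1\cdots a_n\in\mathcal{S}_n$ is a non-empty contiguous sequence of entries $a_ia_{i+1}\cdots a_{i+k}$ whose values form a set of consecutive integers; an interval is identified with its set of values $[a,b]=\{a,a+1,\dots,b\}$. The whole permutation and the single entries are the trivial intervals; all others are proper. A permutation is simple if it has no proper intervals. The interval poset $P(\pi)$ of $\pi\in\mathcal{S}_n$ is the poset whose elements are the (non-empty) intervals of $\pi$, viewed as sets of values $[a,b]\subseteq\{1,\dots,n\}$, ordered by inclusion. Two interval posets are the same if they consist of the same sets of values (equivalently, they are counted as plane posets in which the children of each node are ordered from left to right by increasing minimum). Inflation: for $\sigma\in\mathcal{S}_k$ and $\alpha_i\in\mathcal{S}_{n_i}$ ($n_i\ge1$, $1\le i\le k$), $\sigma[\alpha_1,\dots,\alpha_k]\in\mathcal{S}_{n_1+\cdots+n_k}$ is the permutation obtained by replacing the $i$-th entry of $\sigma$, for each $i$, by a block of $n_i$ consecutive positions and consecutive values that is order-isomorphic to $\alpha_i$, the blocks being in the same relative order (in values) as the entries of $\sigma$. Example: $2413[213,21,132,1]=546\,98\,132\,7$. Block-wise simple permutations are defined recursively: (1) the permutation $1\in\mathcal{S}_1$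 is block-wise simple; (2) $\pi\in\mathcal{S}_n$ is block-wise simple if there are a simple permutation $\sigma\in\mathcal{S}_k$ with $k\ge 4$ and block-wise simple permutations $\alpha_1,\dots,\alpha_k$ such that $\pi=\sigma[\alpha_1,\dots,\alpha_k]$. No other permutations are block-wise simple. *)

(* Defs.v *)
From HB Require Import structures.
From mathcomp Require Import all_boot all_order all_fingroup.
From mathcomp Require Import boolp.

Set Implicit Arguments.
Unset Strict Implicit.
Unset Printing Implicit Defensive.

(* A permutation a_1 ... a_n of {1, ..., n} is represented by pi : 'S_n, a
   permutation of {0, ..., n-1}: pi i is the entry at position i, and both
   positions and values are shifted by one. *)

Definition segment n (a b : 'I_n) : {set 'I_n} := [set x : 'I_n | a <= x <= b].

Definition is_segment n (A : {set 'I_n}) : bool :=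
  [exists a : 'I_n, exists b : 'I_n, (a <= b) && (A == segment a b)].

(* An interval is identified with its set of values, the image of the set of
   positions that it occupies. *)
Definition is_interval n (pi : 'S_n) (V : {set 'I_n}) : bool :=
  [exists A : {set 'I_n}, [&& is_segment A, is_segment V & V == pi @: A]].

(* The order of an interval poset is always inclusion, so the poset is given by
   its set of elements, and two interval posets are the same if and only if
   these sets are equal. *)
Definition interval_poset n (pi : 'S_n) : {set {set 'I_n}} :=
  [set V | is_interval pi V].

Definition trivial_interval n (V : {set 'I_n}) : bool :=
  (V == [set: 'I_n]) || (#|V| == 1).

Definition simple_perm n (pi : 'S_n) : bool :=
  [forall V : {set 'I_n}, is_interval pi V ==> trivial_interval V].

Section Inflation.

Variables (k : nat) (sigma : 'S_k) (n_ : 'I_k -> nat).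
Variable alpha : forall i : 'I_k, 'S_(n_ i).

(* The position x = n_0 + ... + n_(i-1) + j, with j < n_ i, is the j-th position
   of the i-th block: tagnat.sig1 x = i and tagnat.sig2 x = j (tagnat.rect). The
   values in this block lie above those of all blocks i' with
   sigma i' < sigma i. *)
Definition inflation_nat (x : 'I_(\sum_i n_ i)) : nat :=
  \sum_(i' | sigma i' < sigma (tagnat.sig1 x)) n_ i'
    + alpha (tagnat.sig1 x) (tagnat.sig2 x).

Let offset (i : 'I_k) := \sum_(i' | sigma i' < sigma i) n_ i'.

Let leq_offset (i : 'I_k) (P : pred 'I_k) :
  (forall i', sigma i' <= sigma i -> P i') ->
  offset i + n_ i <= \sum_(i' | P i') n_ i'.
Proof.
move=> leP; rewrite [leqRHS](bigID (fun i' => sigma i' < sigma i)) /=.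
apply: leq_add.
  rewrite [leqRHS](eq_bigl (fun i' => sigma i' < sigma i)) // => i' /=.
  by case: ltnP => [/ltnW/leP->|]; rewrite ?andbF.
by rewrite (bigD1 i) ?ltnn ?leP ?leqnn //= leq_addr.
Qed.

Lemma inflation_subproof (x : 'I_(\sum_i n_ i)) :
  inflation_nat x < \sum_i n_ i.
Proof.
apply: (@leq_trans (offset (tagnat.sig1 x) + n_ (tagnat.sig1 x))).
  by rewrite ltn_add2l ltn_ord.
exact: leq_offset.
Qed.

Lemma inflation_inj : injective (fun x => Ordinal (inflation_subproof x)).
Proof.
have block_lt x y : sigma (tagnat.sig1 x) < sigma (tagnat.sig1 y) ->
    inflation_nat x < inflation_nat y.
  move=> lt_xy; apply: (@leq_trans (offset (tagnat.sig1 y))); last exact: leq_addr.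
  apply: (@leq_trans (offset (tagnat.sig1 x) + n_ (tagnat.sig1 x))).
    by rewrite ltn_add2l ltn_ord.
  by apply: leq_offset => i' /leq_ltn_trans; apply.
move=> x y /(congr1 val) /= eq_xy.
case: (ltngtP (sigma (tagnat.sig1 x)) (sigma (tagnat.sig1 y))).
- by move/block_lt; rewrite eq_xy ltnn.
- by move/block_lt; rewrite eq_xy ltnn.
move/val_inj/perm_inj; rewrite -[x]tagnat.sigK -[y]tagnat.sigK => e.
congr tagnat.rank; move: e eq_xy; rewrite !tagnat.sigK /inflation_nat.
rewrite /tagnat.sig1 /tagnat.sig2.
case: (tagnat.sig x) (tagnat.sig y) => [i j] [i' j'] /= e.
by case: _ / e j' => j' /eqP; rewrite eqn_add2l => /eqP/val_inj/perm_inj->.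
Qed.

Definition inflation : 'S_(\sum_i n_ i) := perm inflation_inj.

End Inflation.

(* The blocks are nonempty as required of an inflation: there is no block-wise
   simple permutation of length 0. *)
Inductive block_wise_simple : forall n : nat, 'S_n -> Prop :=
| BlockWiseSimple1 : block_wise_simple (1%g : 'S_1)
| BlockWiseSimpleInflation (k : nat) (sigma : 'S_k) (n_ : 'I_k -> nat)
    (alpha : forall i : 'I_k, 'S_(n_ i)) :
    4 <= k -> simple_perm sigma ->
    (forall i : 'I_k, block_wise_simple (alpha i)) ->
    block_wise_simple (inflation sigma alpha).

Definition block_wise_simple_posets (n : nat) : {set {set {set 'I_n}}} :=
  [set interval_poset pi | pi : 'S_n & `[< block_wise_simple pi >]].

(* Main.v *)
Require Import Defs.
From HB Require Import structures.
From mathcomp Require Import all_boot all_order all_fingroup all_algebra.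
From mathcomp Require Import boolp zify ring.

(* If sigma is simple of length at least 4, every interval of
   sigma[alpha_1, ..., alpha_k] is the whole permutation or an interval inside
   one block. Hence the interval poset of a block-wise simple permutation is a
   plane tree in which every internal vertex has at least 4 children, and every
   such tree occurs because there are simple permutations of each length k >= 4.
   The generating function T of these trees by number of leaves satisfies
   T = x + T^4 / (1 - T), that is T = x phi(T) for phi = 1 / (1 - t^3 / (1 - t)),
   and Lagrange inversion gives n [x^n] T = [t^(n-1)] phi^n. *)

Set Implicit Arguments.
Unset Strict Implicit.
Unset Printing Implicit Defensive.

(** * Forests and their vertices *)

(* [Leaf f] is a one-vertex tree followed by the forest [f]; [Node c f] is a
   tree whose root has the trees of [c] as children, followed by [f]. *)
Inductive forest := Nil | Leaf of forest | Node of forest & forest.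

Lemma forest_eq_dec : comparable forest.
Proof. by rewrite /comparable /decidable; decide equality. Qed.

HB.instance Definition _ := hasDecEq.Build forest (compareP forest_eq_dec).

Fixpoint leaves (f : forest) : nat :=
  match f with
  | Nil => 0
  | Leaf f => (leaves f).+1
  | Node c f => leaves c + leaves f
  end.

Fixpoint width (f : forest) : nat :=
  match f with Nil => 0 | Leaf f | Node _ f => (width f).+1 end.

Fixpoint bushy (f : forest) : bool :=
  match f with
  | Nil => true
  | Leaf f => bushy f
  | Node c f => [&& 4 <= width c, bushy c & bushy f]
  end.

Fixpoint fcat (f g : forest) : forest :=
  match f with
  | Nil => g
  | Leaf f => Leaf (fcat f g)
  | Node c f => Node c (fcat f g)
  end.

Fixpoint ftake (k : nat) (f : forest) : forest :=
  match k, f with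
  | k.+1, Leaf f => Leaf (ftake k f)
  | k.+1, Node c f => Node c (ftake k f)
  | _, _ => Nil
  end.

Fixpoint fdrop (k : nat) (f : forest) : forest :=
  match k, f with
  | k.+1, Leaf f | k.+1, Node _ f => fdrop k f
  | _, _ => f
  end.

(* The vertex set of a forest whose leaves are numbered from [o] on: a vertex is
   recorded as (first leaf below it, number of leaves below it). *)
Fixpoint vertices (o : nat) (f : forest) : seq (nat * nat) :=
  match f with
  | Nil => [::]
  | Leaf f => (o, 1) :: vertices o.+1 f
  | Node c f => (o, leaves c) :: vertices o c ++ vertices (o + leaves c) f
  end.

Lemma leaves_cat f g : leaves (fcat f g) = leaves f + leaves g.
Proof. by elim: f => //= [f -> //|c _ f ->]; rewrite addnA. Qed.

Lemma width_cat f g : width (fcat f g) = width f + width g.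
Proof. by elim: f => //= [f -> //|c _ f ->]. Qed.

Lemma bushy_cat f g : bushy (fcat f g) = bushy f && bushy g.
Proof. by elim: f => //= c _ f ->; rewrite !andbA. Qed.

Lemma fcat_takedrop k f : fcat (ftake k f) (fdrop k f) = f.
Proof. by elim: k f => [|k IHk] [|f|c f] //=; rewrite IHk. Qed.

Lemma ftake_cat f g : ftake (width f) (fcat f g) = f.
Proof. by elim: f => //= [f -> //|c _ f -> //]. Qed.

Lemma fdrop_cat f g : fdrop (width f) (fcat f g) = g.
Proof. by elim: f => //=; case: g. Qed.

Lemma width_take k f : k <= width f -> width (ftake k f) = k.
Proof. by elim: k f => [|k IHk] [|f|c f] //= /IHk->. Qed.

Lemma vertices_cat o f g :
  vertices o (fcat f g) = vertices o f ++ vertices (o + leaves f) g.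
Proof.
elim: f o => [|f IHf|c _ f IHf] o //=; first by rewrite addn0.
- by rewrite IHf addSnnS.
- by rewrite IHf catA addnA.
Qed.

Lemma vertices_shift d o f :
  vertices (d + o) f = [seq (d + v.1, v.2) | v <- vertices o f].
Proof.
elim: f o => [|f IHf|c IHc f IHf] o //=; first by rewrite -IHf addnS.
by rewrite map_cat -IHc -IHf addnA.
Qed.

Lemma mem_vertices_shift d o f a l :
  (d + a, l) \in vertices (d + o) f = ((a, l) \in vertices o f).
Proof.
rewrite vertices_shift; apply/mapP/idP => [[[a' l'] av [/addnI-> ->]]|av] //.
by exists (a, l).
Qed.

Lemma bushy_width_leaves f : bushy f -> width f <= leaves f.
Proof.
elim: f => //= c IHc f IHf /and3P[w /IHc c_ge /IHf f_ge].
by rewrite -add1n leq_add // (leq_trans _ c_ge) // (leq_trans _ w).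
Qed.

Lemma bushy_leaves0 f : bushy f -> leaves f = 0 -> f = Nil.
Proof. by move=> /bushy_width_leaves w f0; move: w; rewrite f0; case: f f0. Qed.

Lemma vertices_bound o f a l : bushy f -> (a, l) \in vertices o f ->
  [/\ o <= a, 0 < l & a + l <= o + leaves f].
Proof.
elim: f o => //= [f IHf|c IHc f IHf] o.
  move=> bf; rewrite inE => /predU1P[[-> ->]|/(IHf _ bf)[]]; first by split; lia.
  by split; lia.
case/and3P=> w bc bf; have := bushy_width_leaves bc.
rewrite inE mem_cat => c_ge /predU1P[[-> ->]|/orP[/(IHc _ bc)[]|/(IHf _ bf)[]]];
  by split; lia.
Qed.

(** A pair spanning all leaves can only be the root of a single tree. Hence a node, having at least
    four children, never has the same leaves as one of its descendants. *)
Lemma vertices_root o f : bushy f -> (o, leaves f) \in vertices o f ->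
  width f <= 1.
Proof.
case: f => //= [f|c f].
  move=> bf; rewrite inE => /predU1P[[]|/(vertices_bound bf)[]]; last lia.
  by move/(bushy_leaves0 bf)->.
case/and3P=> w bc bf; have c_ge := bushy_width_leaves bc.
suff f0: leaves f = 0 -> width f < 1.
  rewrite inE mem_cat => /predU1P[[]|/orP[]]; first by move=> e; apply: f0; lia.
    by move/(vertices_bound bc) => [_ _ ?]; apply: f0; lia.
  by move/(vertices_bound bf) => []; lia.
by move/(bushy_leaves0 bf)->.
Qed.

Lemma Node_first_vertex o c f l : bushy (Node c f) ->
  (o, l) \in vertices o (Node c f) -> l <= leaves c.
Proof.
move=> /= /and3P[w bc bf]; have c_ge := bushy_width_leaves bc.
rewrite inE mem_cat => /predU1P[[->]|/orP[]] //.
  by move/(vertices_bound bc) => []; lia.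
by move/(vertices_bound bf) => []; lia.
Qed.

(** The longest vertex starting at [o] is the root of the first tree. Its length splits the
    remaining vertices: those ending within it belong to its children, those starting after it to
    the rest of the forest. *)
Lemma vertices_inj o f g : bushy f -> bushy g -> leaves f = leaves g ->
  vertices o f =i vertices o g -> f = g.
Proof.
(* At [o'] the first forest has only a vertex with one leaf, while a bushy node there has at least
   four. *)
have LeafNode o' f' c' g' : bushy f' -> bushy (Node c' g') ->
    ~ vertices o' (Leaf f') =i vertices o' (Node c' g').
  move=> bf /= /and3P[w bc _] /(_ (o', leaves c')).
  have := bushy_width_leaves bc; rewrite !inE eqxx /=.
  by move=> c_ge /predU1P[[]|/(vertices_bound bf)[]]; lia.
elim: f o g => [|f IHf|c IHc f IHf] o g.
- by move=> _ bg /esym/(bushy_leaves0 bg).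
- case: g => [|g|c g] // bf bg; last by move=> _ /LeafNode-/(_ bf bg).
  move=> [fg] eq_fg; congr Leaf; apply: (IHf o.+1) => // -[a l].
  have := eq_fg (a, l); rewrite !inE !xpair_eqE.
  case: eqP => //= -> _.
  by apply/idP/idP => /vertices_bound[] //; rewrite ltnn.
- case: g => [|g|c' g] bf bg.
  + by case/and3P: bf => w /bushy_width_leaves /=; lia.
  + by move=> _ eq_fg; case: (LeafNode o g c f bg bf) => v; rewrite eq_fg.
  move=> /= eq_l eq_fg.
  have eqL: leaves c = leaves c'.
    apply/eqP; rewrite eqn_leq.
    rewrite (@Node_first_vertex o c' g) -?eq_fg //= ?mem_head //.
    by rewrite (@Node_first_vertex o c f) ?eq_fg //= ?mem_head.
  case/and3P: bf bg => w bc bf /and3P[w' bc' bg].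
  have c_ge := bushy_width_leaves bc.
  congr Node.
    apply: (IHc o) => // -[a l]; have := eq_fg (a, l).
    rewrite /= !inE !mem_cat !xpair_eqE -eqL.
    case: (leqP (a + l) (o + leaves c)) => [le_al|gt_al] H; last first.
      by move=> {eq_fg H}; apply/idP/idP => /vertices_bound[] //; lia.
    (* For the root pair itself [eq_fg] says nothing; it is a vertex of neither [c] nor [c'], as
       both have width at least 4. *)
    case E: ((a == o) && (l == leaves c)).
      case/andP: E => /eqP-> /eqP->; rewrite {2}eqL.
      move=> {eq_fg H}; apply/idP/idP; last by move/(vertices_root bc'); lia.
      by move/(vertices_root bc); lia.
    rewrite E /= in H.
    suff zero h : bushy h -> (a, l) \in vertices (o + leaves c) h = false.
      by rewrite !zero ?orbF in H.
    by move=> {eq_fg E H} bh; apply/negP => /(vertices_bound bh)[]; lia.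
  apply: (IHf (o + leaves c)) => // [|[a l]]; first by lia.
  have := eq_fg (a, l); rewrite /= !inE !mem_cat !xpair_eqE -eqL.
  case: (leqP (o + leaves c) a) => [le_a|gt_a] H; last first.
    by move=> {eq_fg H}; apply/idP/idP => /vertices_bound[] //; lia.
  have E: (a == o) = false by apply/eqP; lia.
  rewrite E /= in H.
  suff zero h : bushy h -> leaves h = leaves c -> (a, l) \in vertices o h = false.
    by rewrite !zero in H.
  by move=> {eq_fg E H} bh eh; apply/negP => /(vertices_bound bh)[]; lia.
Qed.

(** * Enumeration of bushy forests by leaves and trees *)

Section Enumeration.

Variable N : nat.

(* The forests with [n] leaves and [m] trees: a first tree [Node c _] with
   [width c = k] is obtained by joining the first [k] trees of a forest with
   [k - 1] more trees. The recursion is on [d], and [2 * n <= d + m] is enough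
   for it to reach all forests. *)
Fixpoint forests (d n m : nat) : seq forest :=
  match n, m, d with
  | 0, 0, _ => [:: Nil]
  | n'.+1, m'.+1, d'.+1 =>
      [seq Leaf f | f <- forests d' n' m']
      ++ [seq Node (ftake k f) (fdrop k f)
         | k <- iota 4 N, f <- forests d' n (k + m')]
  | _, _, _ => [::]
  end.

Lemma forests_sound d n m f : f \in forests d n m ->
  [/\ bushy f, leaves f = n & width f = m].
Proof.
elim: d n m f => [|d IHd] [|n] [|m] f //=; try by rewrite inE => /eqP->.
rewrite mem_cat => /orP[/mapP[g /IHd[bg lg wg] ->]|].
  by split=> //=; rewrite ?lg ?wg.
case/allpairsPdep=> k [g [k_in /IHd[bg lg wg] ->]] /=.
rewrite mem_iota in k_in; rewrite -(fcat_takedrop k g) in bg lg wg.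
rewrite bushy_cat in bg; rewrite leaves_cat in lg; rewrite width_cat in wg.
have := congr1 width (fcat_takedrop k g); rewrite width_cat wg => wg'.
rewrite width_take ?bg -?wg' ?leq_addr // in wg *.
by split=> //=;
  [case/andP: k_in => -> | move/eqP: wg; rewrite eqn_add2l => /eqP->].
Qed.

(** Removing a leaf lowers [2 * leaves f] by 2 and [d + width f] by 2; opening a node keeps the
    leaves and widens the forest by at least 3, which outweighs the loss of 1 in [d]. The bound [N]
    puts [width c], at most [leaves c], within [iota 4 N]. *)
Lemma forests_complete d f : bushy f -> leaves f < N ->
  2 * leaves f <= d + width f -> f \in forests d (leaves f) (width f).
Proof.
elim: d f => [|d IHd] [|f|c f]; try by rewrite inE.
- by move=> /bushy_width_leaves /= w _ d_ge; lia.
- by move=> /bushy_width_leaves /= w _ d_ge; lia.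
- move=> /= bf lf d_ge; rewrite mem_cat map_f ?IHd //; lia.
move=> bcf lcf d_ge; have := bushy_width_leaves bcf; move: bcf lcf d_ge => /=.
case/and3P=> w bc bf; have := bushy_width_leaves bc => c_ge lcf d_ge cf_ge.
have /prednK <-: 0 < leaves c + leaves f by lia.
rewrite mem_cat; apply/orP; right; apply/allpairsPdep.
exists (width c), (fcat c f); rewrite ftake_cat fdrop_cat mem_iota w; split=> //=.
  by lia.
rewrite prednK; last lia.
rewrite -leaves_cat -width_cat; apply: IHd; rewrite ?bushy_cat ?bc //.
  by rewrite leaves_cat.
by rewrite leaves_cat width_cat; lia.
Qed.

Lemma forests_uniq d n m : uniq (forests d n m).
Proof.
elim: d n m => [|d IHd] [|n] [|m] //=.
rewrite cat_uniq map_inj_uniq ?IHd => [|f g []] //=; apply/andP; split.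
  by apply/hasPn => f /allpairsPdep[k [g [_ _ ->]]]; apply/mapP => -[].
apply: allpairs_uniq_dep => [|k _|]; [exact: iota_uniq | exact: IHd |].
move=> p p' /allpairsPdep[k [f [_ /forests_sound[_ _ wf] ->]]].
move=> /allpairsPdep[k' [f' [_ /forests_sound[_ _ wf'] ->]]] /= [eqt eqd].
have eqk: k = k'.
  by have := congr1 width eqt; rewrite !width_take ?wf ?wf' ?leq_addr.
by rewrite -(fcat_takedrop k f) -(fcat_takedrop k' f') eqt eqd eqk.
Qed.

Lemma size_forests d n m :
  size (forests d.+1 n.+1 m.+1) =
    size (forests d n m) + \sum_(j < N) size (forests d n.+1 (j + m + 4)).
Proof.
rewrite /= size_cat size_map size_allpairs_dep; congr (_ + _).
rewrite sumnE big_map -[4]addn0 iotaDl big_map -val_enum_ord big_map big_enum.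
by apply: eq_bigr => j _; rewrite addn0 -addnA addnC.
Qed.

End Enumeration.

(** * Intervals of an inflation *)

Definition seg n (a l : nat) : {set 'I_n} := [set x : 'I_n | a <= x < a + l].

Definition convex n (A : {set 'I_n}) : Prop :=
  forall x y z : 'I_n, x <= y <= z -> x \in A -> z \in A -> y \in A.

(* [a], ..., [a + l - 1] are the values of an interval: since they are
   consecutive, it remains to require that their positions are. *)
Definition values_interval n (pi : 'S_n) (a l : nat) : Prop :=
  [/\ 0 < l, a + l <= n &
      forall x y z : 'I_n, x <= y <= z ->
        a <= pi x < a + l -> a <= pi z < a + l -> a <= pi y < a + l].

Lemma is_segmentP n (A : {set 'I_n}) :
  reflect (A != set0 /\ convex A) (is_segment A).
Proof.
apply: (iffP existsP) => [[a /existsP[b /andP[le_ab /eqP->]]]|[/set0Pn[x0 x0A] cA]].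
  split; first by apply/set0Pn; exists a; rewrite inE leqnn.
  by move=> x y z; rewrite !inE; lia.
case: (arg_minnP (fun x : 'I_n => val x) x0A) => a aA min_a.
case: (arg_maxnP (fun x : 'I_n => val x) x0A) => b bA max_b.
exists a; apply/existsP; exists b; rewrite min_a //=.
apply/eqP/setP => x; rewrite inE; apply/idP/idP => [xA|/cA->//].
by rewrite min_a //=; apply: max_b.
Qed.

Lemma segment_seg n (V : {set 'I_n}) : is_segment V ->
  exists a l, [/\ 0 < l, a + l <= n & V = seg n a l].
Proof.
case/existsP=> a /existsP[b /andP[le_ab /eqP->]].
exists a, (b - a).+1; split=> //; first by have := ltn_ord b; lia.
by apply/setP => x; rewrite !inE; lia.
Qed.

Lemma seg_is_segment n a l : 0 < l -> a + l <= n -> is_segment (seg n a l).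
Proof.
move=> l_gt0 aln; apply/is_segmentP; split; last by move=> x y z; rewrite !inE; lia.
have an : a < n by lia.
by apply/set0Pn; exists (Ordinal an); rewrite inE /=; lia.
Qed.

Lemma seg_inj n a l a' l' : 0 < l -> a + l <= n -> 0 < l' -> a' + l' <= n ->
  seg n a l = seg n a' l' -> (a, l) = (a', l').
Proof.
move=> l0 al l0' al' /setP eqV.
have a_lt : a < n by lia.
have b_lt : (a + l).-1 < n by lia.
have a_lt' : a' < n by lia.
have b_lt' : (a' + l').-1 < n by lia.
move: (eqV (Ordinal a_lt)) (eqV (Ordinal b_lt)) (eqV (Ordinal a_lt'))
  (eqV (Ordinal b_lt')); rewrite !inE /= => h1 h2 h3 h4.
by congr (_, _); lia.
Qed.

Lemma is_intervalP n (pi : 'S_n) (V : {set 'I_n}) :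
  reflect (exists a l, V = seg n a l /\ values_interval pi a l)
          (is_interval pi V).
Proof.
apply: (iffP existsP) => [[A /and3P[/is_segmentP[_ cA]]]|].
  case/segment_seg=> a [l [l0 al defV]] /eqP defA.
  exists a, l; split=> //; split=> // x y z le_xyz.
  have memA t : (a <= pi t < a + l) = (t \in A).
    by rewrite -(mem_imset _ _ (@perm_inj _ pi)) -defA defV inE.
  by rewrite !memA; apply: cA.
move=> [a [l [-> [l0 al conv]]]]; exists (pi @^-1: seg n a l).
have defV : seg n a l = pi @: (pi @^-1: seg n a l).
  apply/setP => x; rewrite -[x](permKV pi) (mem_imset _ _ (@perm_inj _ pi)).
  by rewrite [RHS]inE.
rewrite seg_is_segment // -defV eqxx !andbT; apply/is_segmentP; split.
  have an : a < n by lia.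
  by apply/set0Pn; exists (pi^-1%g (Ordinal an)); rewrite inE permKV inE /=; lia.
by move=> x y z le_xyz; rewrite !inE; apply: conv le_xyz.
Qed.

(** The image under [s] of an index set that is convex in position and in value is an interval, so
    simplicity makes it everything or a single point. *)
Lemma simple_convex k (s : 'S_k) (J : pred 'I_k) i0 : simple_perm s -> J i0 ->
    (forall x y z : 'I_k, x <= y <= z -> J x -> J z -> J y) ->
    (forall x y z : 'I_k, s x <= s y <= s z -> J x -> J z -> J y) ->
  (forall i, J i) \/ (forall i i', J i -> J i' -> i = i').
Proof.
move=> /forallP simp Ji0 posJ valJ.
have memV i : (s i \in s @: [set i | J i]) = J i.
  by rewrite (mem_imset _ _ (@perm_inj _ s)) inE.
have /(implyP (simp _)) : is_interval s (s @: [set i | J i]).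
  apply/existsP; exists [set i | J i]; rewrite eqxx andbT; apply/andP; split.
    apply/is_segmentP; split; first by apply/set0Pn; exists i0; rewrite inE.
    by move=> x y z; rewrite !inE; apply: posJ.
  apply/is_segmentP; split; first by apply/set0Pn; exists (s i0); rewrite memV.
  move=> x y z; rewrite -[x](permKV s) -[y](permKV s) -[z](permKV s) !memV.
  exact: valJ.
case/orP=> [/eqP defV|/cards1P[v defV]]; [left=> i | right=> i i'].
  by rewrite -memV defV inE.
by rewrite -!memV defV !inE => /eqP<- /eqP/perm_inj.
Qed.

(** * Simple permutations of every length at least 4 *)

Section SimplePermExists.

Variable k : nat.
Hypothesis k_ge4 : 4 <= k.

(* In one-line notation on {1, ..., k}: 2 4 ... 2m 1 3 ... 2m-1 if [k = 2m], and
   2 4 ... 2m 1 2m+1 3 5 ... 2m-1 if [k = 2m+1]. *)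
Definition simple_fun (x : nat) : nat :=
  let m := k./2 in
  if x < m then 2 * x + 1
  else if odd k then
    if x == m then 0 else if x == m.+1 then 2 * m else 2 * (x - m - 1)
  else 2 * (x - m).

Lemma simple_fun_lt (x : 'I_k) : simple_fun x < k.
Proof.
by have := ltn_ord x; rewrite /simple_fun /=; do ?case: ifPn => ?; lia.
Qed.

Lemma simple_fun_inj : injective (fun x => Ordinal (simple_fun_lt x)).
Proof.
move=> x y [e]; apply: val_inj => /=; move: e (ltn_ord x) (ltn_ord y).
by rewrite /simple_fun; do !case: ifPn => ?; lia.
Qed.

Lemma simple_perm_exists : exists s : 'S_k, simple_perm s.
Proof.
exists (perm simple_fun_inj); apply/forallP => V; apply/implyP.
case/is_intervalP=> a [l [-> [l0 al]]]; set s := perm _ => conv.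
have sE x : s x = simple_fun x :> nat by rewrite permE.
have [l1|l_gt1] := leqP l 1.
  apply/orP; right; apply/cards1P.
  have an : a < k by lia.
  by exists (Ordinal an); apply/setP => x; rewrite !inE -val_eqE /=; lia.
suff [-> ->] : a = 0 /\ l = k.
  by apply/orP; left; apply/eqP/setP => x; rewrite !inE /= ltn_ord.
pose I x := a <= simple_fun x < a + l.
have convI x y z : x <= y <= z -> z < k -> I x -> I z -> I y.
  move=> xyz zk; have yk : y < k by lia.
  have xk : x < k by lia.
  by have := conv (Ordinal xk) (Ordinal yk) (Ordinal zk) xyz; rewrite !sE.
(* Counted from 0, odd values fill the first [k./2] positions and even values the others, so the
   consecutive values [a] and [a.+1] lie on opposite sides of the middle. *)
have [x [y [x_lt y_ge yk Ix Iy]]] :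
    exists x y, [/\ x < k./2, k./2 <= y, y < k, I x & I y].
  have ak : a < k by lia.
  have ak' : a.+1 < k by lia.
  have /(congr1 val) := permKV s (Ordinal ak).
  have /(congr1 val) := permKV s (Ordinal ak').
  rewrite /= !sE; set y := (s^-1)%g _; set x := (s^-1)%g _.
  move: (val x) (val y) (ltn_ord x) (ltn_ord y) => /= {}x {}y xk yk ey ex.
  have Ix : I x by rewrite /I; lia.
  have Iy : I y by rewrite /I; lia.
  case: (ltnP x k./2) => xm; [exists x, y | exists y, x]; split=> //.
    by move: ex ey; rewrite /simple_fun; do ?case: ifPn => ?; lia.
  by move: ex ey; rewrite /simple_fun; do ?case: ifPn => ?; lia.
(* The two middle positions carry the values [2 * k./2 - 1] and 0, which leaves at most one value
   missing. *)
have I1 : I (k./2).-1 by apply: convI Ix Iy => //; lia.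
have I2 : I (k./2) by apply: convI Ix Iy => //; lia.
have a0 : a = 0 by move: I2; rewrite /I /simple_fun; do ?case: ifPn => ?; lia.
split=> //.
have l_ge : 2 * k./2 <= l.
  by move: I1; rewrite /I /simple_fun; do ?case: ifPn => ?; lia.
case k_odd: (odd k); last by lia.
(* For odd [k] the missing value [2 * k./2] sits between the middle and the last position, whose
   value is already included. *)
have I3 : I (k./2).+1.
  apply: (convI (k./2) _ k.-1) => //; try lia.
  by rewrite /I /simple_fun k_odd; do ?case: ifPn => ?; lia.
by move: I3; rewrite /I /simple_fun k_odd; do ?case: ifPn => ?; lia.
Qed.

End SimplePermExists.

Section InflationIntervals.

Variables (k : nat) (sigma : 'S_k) (n_ : 'I_k -> nat).
Variable alpha : forall i : 'I_k, 'S_(n_ i).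
Hypothesis n_gt0 : forall i, 0 < n_ i.

(** [pos i] and [off i] are the first position and the first value of block [i]. *)
Let pos (i : 'I_k) := \sum_(i' < k | i' < i) n_ i'.
Let off (i : 'I_k) := \sum_(i' | sigma i' < sigma i) n_ i'.
Let elt (i : 'I_k) (j : 'I_(n_ i)) : 'I_(\sum_i n_ i) := tagnat.Rank i j.
Let pi := inflation sigma alpha.

Let leq_block (r : 'I_k -> nat) i (P : pred 'I_k) :
  (forall i', r i' <= r i -> P i') ->
  \sum_(i' | r i' < r i) n_ i' + n_ i <= \sum_(i' | P i') n_ i'.
Proof.
move=> leP; rewrite [leqRHS](bigID (fun i' => r i' < r i)) /=.
apply: leq_add.
  rewrite [leqRHS](eq_bigl (fun i' => r i' < r i)) // => i' /=.
  by case: ltnP => [/ltnW/leP->|]; rewrite ?andbF.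
by rewrite (bigD1 i) ?ltnn ?leP ?leqnn //= leq_addr.
Qed.

Let pos_lt (i i' : 'I_k) : i < i' -> pos i + n_ i <= pos i'.
Proof.
by move=> lt_ii'; apply: (@leq_block val) => i'' /= /leq_ltn_trans; apply.
Qed.

Let off_lt (i i' : 'I_k) : sigma i < sigma i' -> off i + n_ i <= off i'.
Proof.
move=> lt_ii'; apply: (@leq_block (fun i => sigma i)) => i'' /leq_ltn_trans.
exact.
Qed.

Let off_bound i : off i + n_ i <= \sum_i n_ i.
Proof. exact: (@leq_block (fun i => sigma i)). Qed.

Let eltE i (j : 'I_(n_ i)) : elt j = pos i + j :> nat.
Proof. exact: tagnat.RankEsum. Qed.

Let pi_elt i (j : 'I_(n_ i)) : pi (elt j) = off i + alpha i j :> nat.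
Proof.
by rewrite permE /= /inflation_nat /tagnat.sig1 /tagnat.sig2 tagnat.rankK.
Qed.

Let eltP x : exists i (j : 'I_(n_ i)), x = elt j.
Proof. by exists (tagnat.sig1 x), (tagnat.sig2 x); rewrite /elt tagnat.sig2K. Qed.

Let pi_surj v : v < \sum_i n_ i ->
  exists i (j : 'I_(n_ i)), off i + alpha i j = v.
Proof.
move=> v_lt; have [i [j e]] := eltP (pi^-1%g (Ordinal v_lt)).
by exists i, j; rewrite -pi_elt -e permKV.
Qed.

(** Blocks occupy disjoint ranges of values and of positions, so both end points, and then
    everything between them, lie in block [i]. *)
Lemma block_interval i a l : values_interval (alpha i) a l ->
  values_interval pi (off i + a) l.
Proof.
case=> l0 al conv; split=> //; first by have := off_bound i; lia.
have blockP i' (j : 'I_(n_ i')) :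
    off i + a <= off i' + alpha i' j < off i + a + l -> i' = i.
  move=> in_i; have := ltn_ord (alpha i' j).
  case: (ltngtP (sigma i') (sigma i)) => [/off_lt|/off_lt|/val_inj/perm_inj//]; lia.
move=> x y z; have [ix [jx ->]] := eltP x; have [iy [jy ->]] := eltP y.
have [iz [jz ->]] := eltP z; rewrite !pi_elt !eltE => le_xyz Ix Iz.
move: (blockP _ _ Ix) (blockP _ _ Iz) => ex ez; subst ix iz.
have ey : iy = i.
  move: (ltn_ord jx) (ltn_ord jy) (ltn_ord jz).
  by case: (ltngtP iy i) => [/pos_lt|/pos_lt|/val_inj//]; lia.
by subst iy; have := conv jx jy jz; lia.
Qed.

(** A block strictly between two blocks met by the interval, in position or in value, lies wholly
    inside it. So the set [J] of met blocks is convex in both orders, and simplicity leaves all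
    blocks or just one. *)
Lemma inflation_interval a l : 3 <= k -> simple_perm sigma ->
  values_interval pi a l ->
  (a = 0 /\ l = \sum_i n_ i)
  \/ exists i a', a = off i + a' /\ values_interval (alpha i) a' l.
Proof.
move=> k_ge3 simp [l0 al conv].
have convE i i' i'' (j : 'I_(n_ i)) (j' : 'I_(n_ i')) (j'' : 'I_(n_ i'')) :
    pos i + j <= pos i' + j' <= pos i'' + j'' ->
    a <= off i + alpha i j < a + l -> a <= off i'' + alpha i'' j'' < a + l ->
    a <= off i' + alpha i' j' < a + l.
  by have := conv (elt j) (elt j') (elt j''); rewrite !pi_elt !eltE.
pose J i := [exists j : 'I_(n_ i), a <= off i + alpha i j < a + l].
have posJ (i i' i'' : 'I_k) (j' : 'I_(n_ i')) : i < i' -> i' < i'' ->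
    J i -> J i'' -> a <= off i' + alpha i' j' < a + l.
  move=> /pos_lt lt1 /pos_lt lt2 /existsP[j Ij] /existsP[j'' Ij''].
  by apply: convE Ij Ij''; move: (ltn_ord j) (ltn_ord j'); lia.
have valJ (i i' i'' : 'I_k) (j' : 'I_(n_ i')) : sigma i < sigma i' ->
    sigma i' < sigma i'' -> J i -> J i'' -> a <= off i' + alpha i' j' < a + l.
  move=> /off_lt lt1 /off_lt lt2 /existsP[j Ij] /existsP[j'' Ij''].
  by move: (ltn_ord (alpha i j)) (ltn_ord (alpha i' j')); lia.
have [i0 [j0 ea]] : exists i (j : 'I_(n_ i)), off i + alpha i j = a.
  by apply: pi_surj; lia.
have Ji0 : J i0 by apply/existsP; exists j0; lia.
case: (@simple_convex _ sigma J i0 simp Ji0) => [i i' i''|i i' i''|Jall|Juniq].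
- move=> /andP[]; rewrite leq_eqVlt => /predU1P[/val_inj-> //|lt1].
  rewrite leq_eqVlt => /predU1P[/val_inj-> //|lt2] Ji Ji''; apply/existsP.
  by exists (Ordinal (n_gt0 i')); apply: posJ lt1 lt2 Ji Ji''.
- move=> /andP[]; rewrite leq_eqVlt => /predU1P[/val_inj/perm_inj-> //|lt1].
  rewrite leq_eqVlt => /predU1P[/val_inj/perm_inj-> //|lt2] Ji Ji''.
  by apply/existsP; exists (Ordinal (n_gt0 i')); apply: valJ lt1 lt2 Ji Ji''.
- left; suff Iall i (j : 'I_(n_ i)) : a <= off i + alpha i j < a + l.
    have [i [j e]] : exists i (j : 'I_(n_ i)), off i + alpha i j = 0.
      by apply: pi_surj; lia.
    have [i' [j' e']] :
        exists i (j : 'I_(n_ i)), off i + alpha i j = (\sum_i n_ i).-1.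
      by apply: pi_surj; lia.
    by move: (Iall i j) (Iall i' j'); rewrite e e'; lia.
  (* A block not contained in the interval is extremal both in position and in
     value, so that the other blocks would form a proper interval of sigma. *)
  apply: contraT => notI.
  have /card_gt1P[i1 [i2 [ni1 ni2 ni12]]] : 1 < #|predC1 i|.
    by rewrite cardC1 card_ord; lia.
  case: (@simple_convex _ sigma (predC1 i) i1 simp ni1).
  + move=> x y z /andP[xy yz] /= nx nz; apply: contraNneq notI => e; subst y.
    by apply: (posJ x _ z) => //; rewrite ltn_neqAle ?xy ?yz ?andbT // eq_sym.
  + move=> x y z /andP[xy yz] /= nx nz; apply: contraNneq notI => e; subst y.
    apply: (valJ x _ z) => //; rewrite ltn_neqAle ?xy ?yz andbT (inj_eq val_inj);
      by rewrite (inj_eq perm_inj) // eq_sym.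
  + by move/(_ i) => /=; rewrite eqxx.
  + by move/(_ i1 i2 ni1 ni2) => e; rewrite e eqxx in ni12.
(* [j0] carries the smallest value [a]; the largest value [(a + l).-1] must lie in the same block,
   which bounds the length. *)
right; exists i0, (alpha i0 j0); split=> //; split=> //.
  have [i1 [j1 e]] : exists i (j : 'I_(n_ i)), off i + alpha i j = (a + l).-1.
    by apply: pi_surj; lia.
  have e01 : i1 = i0 by apply: Juniq => //; apply/existsP; exists j1; lia.
  by subst i1; have := ltn_ord (alpha i0 j1); lia.
move=> x y z xyz; have := @convE _ _ _ x y z; lia.
Qed.

Lemma inflation_intervalP a l : 3 <= k -> simple_perm sigma ->
  values_interval pi a l <->
  (a = 0 /\ l = \sum_i n_ i)
  \/ exists i a', a = \sum_(i' | sigma i' < sigma i) n_ i' + a'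
                  /\ values_interval (alpha i) a' l.
Proof.
move=> k_ge3 simp; split; first exact: inflation_interval.
case=> [[-> ->]|[i [a' [-> /block_interval//]]]].
split=> [||x y z _ _ _]; rewrite ?add0n ?leqnn ?ltn_ord //.
have k_gt0 : 0 < k by lia.
by rewrite (bigD1 (Ordinal k_gt0)) //= addn_gt0 n_gt0.
Qed.

End InflationIntervals.

(** * Interval posets as trees *)

Definition join (s : seq forest) : forest := foldr fcat Nil s.

Lemma leaves_join s : leaves (join s) = \sum_(t <- s) leaves t.
Proof.
by elim: s => [|t s IHs]; rewrite ?big_nil ?big_cons //= leaves_cat IHs.
Qed.

Lemma width_join s : width (join s) = \sum_(t <- s) width t.
Proof.
by elim: s => [|t s IHs]; rewrite ?big_nil ?big_cons //= width_cat IHs.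
Qed.

Lemma bushy_join s : bushy (join s) = all bushy s.
Proof. by elim: s => //= t s <-; rewrite bushy_cat. Qed.

Lemma fcatf0 f : fcat f Nil = f.
Proof. by elim: f => //= [f ->|c _ f ->]. Qed.

Lemma mem_vertices_join o s v :
  reflect (exists2 i, i < size s
             & v \in vertices (o + \sum_(j < i) leaves (nth Nil s j)) (nth Nil s i))
          (v \in vertices o (join s)).
Proof.
elim: s o => [|t s IHs] o /=; first by apply: (iffP idP) => // -[].
rewrite vertices_cat mem_cat; apply: (iffP orP).
  case=> [vt|/IHs[i i_lt vi]]; first by exists 0; rewrite ?big_ord0 ?addn0.
  by exists i.+1; rewrite ?big_ord_recl //= addnA.
case=> -[|i] i_lt; first by rewrite big_ord0 addn0; left.
by rewrite big_ord_recl /= addnA => vi; right; apply/IHs; exists i.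
Qed.

(** Leaves are numbered by value, not by position, so siblings appear by increasing minimum. *)
Definition realizes n (pi : 'S_n) (f : forest) : Prop :=
  [/\ leaves f = n, bushy f, width f = 1
    & forall a l, values_interval pi a l <-> (a, l) \in vertices 0 f].

Lemma realizes1 : realizes (1%g : 'S_1) (Leaf Nil).
Proof.
split=> // a l; rewrite inE; split=> [[l0 al _]|/eqP[-> ->]].
  by apply/eqP; congr (_, _); lia.
by split=> // x y z _ _ _; rewrite ltn_ord.
Qed.

(** Since leaves follow values, the tree of block [i] is child number [sigma i], and the leaves
    before it number exactly the value offset of the block ([off_s]). *)
Lemma realizes_inflation k (sigma : 'S_k) (n_ : 'I_k -> nat)
    (alpha : forall i : 'I_k, 'S_(n_ i)) (s : seq forest) :
    4 <= k -> simple_perm sigma -> size s = k ->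
    (forall i, realizes (alpha i) (nth Nil s (sigma i))) ->
  realizes (inflation sigma alpha) (Node (join s) Nil).
Proof.
move=> k_ge4 simp sz_s real.
have n_gt0 i : 0 < n_ i.
  have [lf bf w1 _] := real i.
  by have := bushy_width_leaves bf; rewrite w1 lf.
have sum_s (F : forest -> nat) :
    \sum_(t <- s) F t = \sum_i F (nth Nil s (sigma i)).
  rewrite (big_nth Nil) sz_s big_mkord; exact: (reindex_inj (@perm_inj _ sigma)).
have leaves_s : leaves (join s) = \sum_i n_ i.
  by rewrite leaves_join sum_s; apply: eq_bigr => i _; case: (real i).
have width_s : width (join s) = k.
  rewrite width_join sum_s -[RHS]card_ord -sum1_card.
  by apply: eq_bigr => i _; case: (real i).
have off_s i : \sum_(j < sigma i) leaves (nth Nil s j)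
               = \sum_(i' | sigma i' < sigma i) n_ i'.
  rewrite (big_ord_widen k (fun j => leaves (nth Nil s j)) (ltnW (ltn_ord _))).
  rewrite (reindex_inj (@perm_inj _ sigma)).
  by apply: eq_bigr => i' _; case: (real i').
have bushy_s : bushy (join s).
  rewrite bushy_join; apply/allP => t /(nthP Nil)[v]; rewrite sz_s => v_lt <-.
  by case: (real (sigma^-1%g (Ordinal v_lt))); rewrite permKV.
split; rewrite /= ?addn0 ?leaves_s ?width_s ?k_ge4 ?bushy_s // => a l.
have int := @inflation_intervalP _ sigma _ alpha n_gt0 a l (ltnW k_ge4) simp.
rewrite cats0 inE; split=> [/int[[-> ->]|[i [a' [-> int_a']]]]|].
- by rewrite eqxx.
- apply/orP; right; apply/mem_vertices_join; exists (sigma i); first by rewrite sz_s.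
  have [_ _ _ /(_ a' l) [/(_ int_a') mem_a' _]] := real i.
  by rewrite off_s add0n -[X in vertices X _]addn0 mem_vertices_shift.
case/orP=> [/eqP[a_0 l_n]|/mem_vertices_join[v]]; first by apply/int; left.
rewrite sz_s add0n => v_lt; pose i := (sigma^-1%g (Ordinal v_lt)).
have -> : v = sigma i by rewrite permKV.
rewrite off_s => mem_a; apply/int; right; exists i.
have [lf bf _ realP] := real i; have [a_ge _ _] := vertices_bound bf mem_a.
exists (a - \sum_(i' | sigma i' < sigma i) n_ i'); rewrite subnKC //.
split=> //; apply/realP; move: mem_a; rewrite -{1}(subnKC a_ge).
by rewrite -[X in vertices X _]addn0 mem_vertices_shift.
Qed.

Lemma block_wise_simple_realizes n (pi : 'S_n) : block_wise_simple pi ->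
  exists f, realizes pi f.
Proof.
elim=> [|k sigma n_ alpha k_ge4 simp _ real].
  by exists (Leaf Nil); exact: realizes1.
have [t realt] := fin_all_exists real.
exists (Node (join [seq t (sigma^-1%g v) | v <- enum 'I_k]) Nil).
apply: realizes_inflation => //; first by rewrite size_map size_enum_ord.
move=> i; rewrite (nth_map i) ?size_enum_ord // nth_ord_enum permK.
exact: realt.
Qed.

(** Stated for forests so that the induction reaches the children of a node. The node is then
    realized by inflating a simple permutation whose length is the number of children. *)
Lemma bushy_realized_trees f : bushy f ->
  exists2 s, f = join s
  & forall t, t \in s -> exists n (pi : 'S_n), block_wise_simple pi /\ realizes pi t.
Proof.
elim: f => [|f IHf|c IHc f IHf] /=; first by exists [::].
  move=> /IHf[s -> real]; exists (Leaf Nil :: s) => // t.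
  rewrite inE => /predU1P[->|/real//]; exists 1, 1%g; split; last exact: realizes1.
  exact: BlockWiseSimple1.
case/and3P=> w_c /IHc[sc defc real_c] /IHf[sf -> real_f].
exists (Node c Nil :: sf) => // t; rewrite inE => /predU1P[->|/real_f//].
have size_c : size sc = width c.
  rewrite defc width_join -sum1_size big_seq [RHS]big_seq.
  by apply: eq_bigr => u /real_c[n [pi [_ []]]].
have [sigma simp] := simple_perm_exists w_c.
(* Block lengths vary with [i], so each permutation is packed with its length before choice is
   applied. *)
have real i : exists p : {n & 'S_n},
    block_wise_simple (tagged p) /\ realizes (tagged p) (nth Nil sc (sigma i)).
  have /real_c[n [pi real_pi]] : nth Nil sc (sigma i) \in sc.
    by rewrite mem_nth // size_c.
  by exists (Tagged (fun n => 'S_n) pi).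
have [p real_p] := choice real.
exists (\sum_i tag (p i)), (inflation sigma (fun i => tagged (p i))); split.
  by apply: BlockWiseSimpleInflation => // i; case: (real_p i).
have := realizes_inflation w_c simp size_c (fun i => proj2 (real_p i)).
by rewrite -defc.
Qed.

Lemma bushy_tree_realized f : bushy f -> width f = 1 ->
  exists pi : 'S_(leaves f), block_wise_simple pi /\ realizes pi f.
Proof.
move=> /bushy_realized_trees[s -> real]; rewrite width_join.
case: s real => [|t s] real; first by rewrite big_nil.
have width1 u : u \in t :: s -> width u = 1 by move=> /real[n [pi [_ []]]].
rewrite big_seq (eq_bigr (fun=> 1)) -?big_seq ?sum1_size => [/=[/size0nil s0]|//].
rewrite s0 /= fcatf0; case: (real t) => [|n [pi [bws real_t]]].
  by rewrite mem_head.
by have [ln _ _ _] := real_t; move: pi bws real_t; rewrite -ln => pi; exists pi.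
Qed.

(** * Counting interval posets by bushy trees *)

Definition forest_poset n (f : forest) : {set {set 'I_n}} :=
  [set V | has (fun v => V == seg n v.1 v.2) (vertices 0 f)].

Lemma realizes_poset n (pi : 'S_n) f : realizes pi f ->
  interval_poset pi = forest_poset n f.
Proof.
case=> _ _ _ real; apply/setP => V; rewrite !inE.
apply/is_intervalP/hasP => [[a [l [-> /real int]]]|[[a l] /= /real int /eqP->]].
  by exists (a, l) => /=.
by exists a, l.
Qed.

Lemma forest_poset_inj n f g : bushy f -> bushy g -> leaves f = n -> leaves g = n ->
  forest_poset n f = forest_poset n g -> f = g.
Proof.
have sub f' g' : bushy f' -> bushy g' -> leaves f' = n -> leaves g' = n ->
    forest_poset n f' = forest_poset n g' ->
    {subset vertices 0 f' <= vertices 0 g'}.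
  move=> bf bg lf lg /setP eqP_fg [a l] al_f; have := eqP_fg (seg n a l).
  rewrite !inE => eq_has.
  have /hasP[[a' l'] /=] :
      has (fun v => seg n a l == seg n v.1 v.2) (vertices 0 g').
    by rewrite -eq_has; apply/hasP; exists (a, l) => /=.
  have [_ l0 al] := vertices_bound bf al_f; move=> al_g /eqP.
  have [_ l0' al'] := vertices_bound bg al_g.
  by rewrite lf in al; rewrite lg in al'; move/(seg_inj l0 al l0' al')->.
move=> bf bg lf lg eq_fg; apply: (@vertices_inj 0) => // [|v]; first by rewrite lf.
by apply/idP/idP; apply: sub.
Qed.

Lemma card_block_wise_simple_posets n :
  #|block_wise_simple_posets n| = size (forests n.+1 (2 * n) n 1).
Proof.
set F := forests _ _ _ _.
have FP f : f \in F <-> [/\ bushy f, leaves f = n & width f = 1].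
  split; first exact: forests_sound.
  by case=> bf lf wf; rewrite /F -lf -wf; apply: forests_complete => //; lia.
rewrite -(size_map (forest_poset n)).
have uniqF : uniq (map (forest_poset n) F).
  rewrite map_inj_in_uniq ?forests_uniq // => f g /FP[bf lf _] /FP[bg lg _].
  exact: forest_poset_inj.
rewrite -(card_uniqP uniqF); apply: eq_card => P; apply/imsetP/mapP.
  case=> pi; rewrite inE => /asboolP/block_wise_simple_realizes[f real] ->.
  exists f; last exact: realizes_poset.
  by apply/FP; case: real.
case=> f /FP[bf lf wf] ->; have := bushy_tree_realized bf wf; rewrite lf.
case=> pi [bws /realizes_poset real]; exists pi => //.
by rewrite inE; apply/asboolP.
Qed.

(** * Lagrange inversion *)

Import GRing.Theory Num.Theory.

Section Lagrange.

Local Open Scope ring_scope.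

Variable N : nat.

(* 1 / (1 - t) and 1 / (1 - t^3 / (1 - t)), correct up to the order [N]. *)
Definition geo : {poly rat} := \sum_(j < N) 'X^j.

Definition phi : {poly rat} := geo \Po ('X^3 * geo).

Lemma geo_mul (p : {poly rat}) : (1 - p) * (geo \Po p) = 1 - p ^+ N.
Proof.
rewrite -[1 - p]opprB mulNr -[1 - p ^+ N]opprB subrX1 /geo raddf_sum /=.
by congr (- (_ * _)); apply: eq_bigr => i _; rewrite comp_Xn_poly.
Qed.

(** Below order [N], multiplying [geo ^+ n.+1] by 1 - t gives [geo ^+ n], and the coefficients
    follow by Pascal's rule. *)
Lemma coef_geoX n j : (j < N)%N -> (geo ^+ n)`_j = ('C(n + j - 1, j))%:R.
Proof.
elim: n j => [|n IHn] j jN.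
  by rewrite expr0 coef1; case: j {jN} => // j; rewrite bin_small // add0n subn1.
have rec: (1 - 'X) * geo ^+ n.+1 = geo ^+ n - geo ^+ n * 'X^N.
  by rewrite exprS mulrA -{1}[geo]comp_polyXr geo_mul; ring.
elim: j jN => [|j IHj] jN; have := congr1 (fun p : {poly rat} => p`_(_ : nat)) rec.
  move/(_ 0); rewrite mulrBl mul1r !coefB coefXM coefMXn jN !subr0 => ->.
  by rewrite IHn // !bin0.
move/(_ j.+1); rewrite mulrBl mul1r !coefB coefXM coefMXn jN subr0 /=.
move/eqP; rewrite subr_eq => /eqP->; rewrite IHn // IHj ?(ltnW jN) // -natrD.
have -> : (n + j.+1 - 1 = n + j)%N by lia.
have -> : (n.+1 + j - 1 = n + j)%N by lia.
have -> : (n.+1 + j.+1 - 1 = (n + j).+1)%N by lia.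
by rewrite binS.
Qed.

Lemma phi_mul : (1 - 'X^3 * geo) * phi = 1 - ('X^3 * geo) ^+ N.
Proof. exact: geo_mul. Qed.

(* [x^n] H(T) = [t^n] (H * lagrange n) for the solution T of T = x * phi(T). *)
Definition lagrange (n : nat) : {poly rat} :=
  if n is n'.+1 then phi ^+ n' * (phi - 'X * phi^`()) else 1.

(** Taking H = t^m gives the coefficient of x^n in T^m, which counts forests of [m] trees with [n]
    leaves. *)
Definition forest_count (n m : nat) : rat := ('X^m * lagrange n)`_n.

(** This is the passage to the classical form of Lagrange inversion: n phi^(n-1) (phi - t phi') = n
    phi^n - t (phi^n)'. *)
Lemma coef_lagrange n j :
  n.+1%:R * (lagrange n.+1)`_j = (n.+1%:R - j%:R) * (phi ^+ n.+1)`_j.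
Proof.
have E : n.+1%:R *: lagrange n.+1
         = n.+1%:R *: phi ^+ n.+1 - 'X * (phi ^+ n.+1)^`().
  rewrite /= mulrBr scalerBr -exprSr deriv_exp /= -mulrnAr -!scaler_nat.
  by rewrite -!scalerAr; congr (_ - _ *: _); ring.
have := congr1 (fun p : {poly rat} => p`_j) E.
rewrite coefZ coefB coefZ coefXM => ->; rewrite mulrBl; congr (_ - _).
by case: j {E} => [|j] /=; [rewrite mul0r | rewrite coef_deriv mulr_natl].
Qed.

Lemma forest_count0 m : forest_count 0 m = (m == 0)%:R.
Proof. by rewrite /forest_count mulr1 coefXn eq_sym. Qed.

Lemma forest_count_small n m : (n < m)%N -> forest_count n m = 0.
Proof. by rewrite /forest_count coefXnM => ->. Qed.

Lemma forest_countS0 n : forest_count n.+1 0 = 0.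
Proof.
apply: (@mulfI _ n.+1%:R); first by rewrite pnatr_eq0.
by rewrite /forest_count mul1r coef_lagrange subrr mul0r mulr0.
Qed.

(** This is the coefficient form of T^(m+1) = x T^m + T^(m+4) / (1 - T). It holds because 1 - t^3
    [geo] inverts [phi] up to a truncation error of order 3N, beyond the coefficient read. *)
Lemma forest_count_rec n m : (n < N)%N ->
  forest_count n.+1 m.+1 =
    forest_count n m + \sum_(j < N) forest_count n.+1 (j + m + 4).
Proof.
move=> nN; apply/eqP; rewrite -subr_eq; apply/eqP.
have -> : \sum_(j < N) forest_count n.+1 (j + m + 4)
          = ('X^(m.+1) * ('X^3 * geo) * lagrange n.+1)`_n.+1.
  rewrite /geo !mulr_sumr mulr_suml coef_sum; apply: eq_bigr => j _.
  by rewrite -!exprD; congr (('X^_ * _)`_ _); lia.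
have E : 'X^(m.+1) * lagrange n.+1 - 'X^(m.+1) * ('X^3 * geo) * lagrange n.+1
         = 'X * ('X^m * ((1 - 'X^3 * geo) * lagrange n.+1)).
  by rewrite exprS; ring.
rewrite -coefB E coefXM [_.+1.-1]/= {E}.
have small (p : {poly rat}) : (('X^3 * geo) ^+ N * p)`_n = 0.
  rewrite exprMn -exprM -mulrA coefXnM ifT //; lia.
rewrite /forest_count; case: n nN small => [|n] nN small.
  (* [lagrange 1] is not [phi * lagrange 0]; the extra derivative term is divisible by t and
     vanishes in the constant coefficient. *)
  have -> : 'X^m * ((1 - 'X^3 * geo) * lagrange 1) = 'X^m * lagrange 0
     - ('X^3 * geo) ^+ N * 'X^m - 'X * ('X^m * (1 - 'X^3 * geo) * phi^`()).
    by rewrite /lagrange expr0 mul1r mulrBr phi_mul; ring.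
  by rewrite !coefB small coefXM !subr0.
have -> : 'X^m * ((1 - 'X^3 * geo) * lagrange n.+2) = 'X^m * lagrange n.+1
   - ('X^3 * geo) ^+ N * ('X^m * lagrange n.+1).
  have -> : lagrange n.+2 = phi * lagrange n.+1 by rewrite /lagrange exprS mulrA.
  by rewrite [_ * (phi * _)]mulrA phi_mul; ring.
by rewrite coefB small subr0.
Qed.

(** Both sides obey the same recurrence; once [d] is 0, a positive [n] is less than [m] and both
    sides vanish. *)
Lemma size_forests_count d n m : (n < N)%N -> (2 * n <= d + m)%N ->
  (size (forests N d n m))%:R = forest_count n m.
Proof.
elim: d n m => [|d IHd] [|n] [|m] nN d_ge //=;
  rewrite ?forest_count0 ?forest_countS0 //.
  by rewrite forest_count_small //; lia.
rewrite -/(forests N d.+1 n.+1 m.+1) size_forests natrD natr_sum.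
rewrite forest_count_rec ?IHd ?(ltnW nN) //; last by lia.
by congr (_ + _); apply: eq_bigr => j _; rewrite IHd //; lia.
Qed.

Lemma exprX3geo i : ('X^3 * geo) ^+ i = 'X^(3 * i) * geo ^+ i.
Proof. by rewrite [LHS]exprMn -exprM. Qed.

Lemma coef_phiX n k : (n < N)%N ->
  (phi ^+ k)`_n =
    \sum_(0 <= i < (n %/ 3).+1) 'C(k + i - 1, i)%:R * ('X^(3 * i) * geo ^+ i)`_n.
Proof.
move=> nN; rewrite /phi -rmorphXn /= coef_comp_poly.
pose F i := (geo ^+ k)`_i * (('X^3 * geo) ^+ i)`_n.
have F0 i : (n %/ 3 < i)%N -> F i = 0.
  by move=> ni; rewrite /F exprX3geo coefXnM ifT ?mulr0 //; lia.
(* The composition sum stops at [size (geo ^+ k)], which may lie on either side of the cutoff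
   [n %/ 3]; both sums are compared on a longer common range. *)
have extend a : \sum_(0 <= i < a) F i = \sum_(0 <= i < a + (n %/ 3).+1) F i
    -> \sum_(0 <= i < a) F i = \sum_(0 <= i < (n %/ 3).+1) F i.
  move->; rewrite addnC (@big_cat_nat _ _ _ (n %/ 3).+1) //= ?leq_addr //.
  by rewrite [X in _ + X]big_nat [X in _ + X]big1 ?addr0 // => i /andP[/F0].
rewrite -(big_mkord xpredT F) extend.
  apply: eq_big_nat => i /andP[_ i_le]; rewrite /F exprX3geo coef_geoX //.
  by lia.
rewrite [RHS](@big_cat_nat _ _ _ (size (geo ^+ k))) //= ?leq_addr //.
rewrite [X in _ = _ + X]big_nat [X in _ = _ + X]big1 ?addr0 // => i /andP[i_ge _].
by rewrite /F nth_default ?mul0r.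
Qed.

Lemma forest_count1 n : (1 < n <= N)%N ->
  forest_count n 1 = n%:R^-1 *
    \sum_(1 <= i < ((n - 1) %/ 3).+1)
      ('C(n + i - 1, i) * 'C(n - 2 * i - 2, i - 1))%N%:R.
Proof.
case: n => // n /andP[n_gt0 nN].
apply: (@mulfI _ n.+1%:R); first by rewrite pnatr_eq0.
rewrite mulVKf ?pnatr_eq0 // /forest_count coefXM /= -/(lagrange n.+1).
rewrite coef_lagrange -natrB // subSnn mul1r coef_phiX // subn1 /=.
(* The term i = 0 is a positive-degree coefficient of a constant, hence 0. *)
rewrite big_ltn // expr0 mulr1 coefXn muln0 gtn_eqF // mulr0 add0r.
apply: eq_big_nat => i /andP[i_gt0 i_le]; rewrite natrM; congr (_ * _).
(* The coefficient is C(n-2i-1, n-3i), with [n] now one less than the length; symmetry turns it into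
   C(n-2i-1, i-1). *)
rewrite coefXnM ifF ?coef_geoX; [|lia..].
by congr (_%:R); rewrite -bin_sub; [congr 'C(_, _)|]; lia.
Qed.

End Lagrange.

Local Open Scope ring_scope.

Theorem theorem4p4 (n : nat) (hn : (4 <= n)%N) :
  (#|block_wise_simple_posets n|%:R : rat) =
    n%:R^-1 *
    \sum_(1 <= i < ((n - 1) %/ 3).+1)
      ('C(n + i - 1, i) * 'C(n - 2 * i - 2, i - 1))%N%:R.
Proof.
rewrite card_block_wise_simple_posets size_forests_count ?leq_addr //.
by apply: forest_count1; rewrite leqnSn andbT; lia.
Qed.
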